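(* Every weakly developable $T_1$ space $X$ is weakly semi-metrizable. Moreover, there exist a distance function $d$ on $X$ and a family $\mathcal V=\{V_n^x\mid x\in X,n\in\mathbb N\}$ of subsets of $X$ adapted to $d$ such that $(X,d,\mathcal V)$ is a weakly semi-metric space, the topology of $X$ equals $\mathcal T_{d,\mathcal V}$, and, for every $x\in X$ and $n\in\mathbb N$, the set $V_n^x$ is open in $X$ and $d(y_1,y_2)<2^{-n}$ for all $y_1,y_2\in V_n^x$.
   Context: All topological spaces are assumed $T_1$, and $\mathbb N=\{1,2,3,\dots\}$. A space $X$ is weakly developable if it has a weak development, i.e. a sequence $(\mathcal G_n)_n$ of open covers of $X$ such that, for every $x\in X$ and every sequence $(G_n)_n$ with $x\in G_n\in\mathcal G_n$ for every $n$, the sequence $(\bigcap_{i\le n}G_i)_n$ is a base at $x$. A distance function on a nonempty set $X$ is a function $d:X\times X\to[0,\infty)$ with $d(x,y)=0\iff x=y$ and $d(x,y)=d(y,x)$ for all $x,y$ (no triangle inequality). Put $B(x,\varepsilon)=\{y\in X\mid d(x,y)<\varepsilon\}$. A family $\mathcal V=\{V_n^x\mid x\in X,n\in\mathbb N\}$ of subsets of $X$ is adapted to $d$ if $x\in\bigcap_{k=1}^nV_k^x\subset B(x,2^{-n})$ for all $x\in X$, $n\in\mathbb N$. In this case $\mathcal T_{d,\mathcal V}$ is the topology on $X$ in which $U$ is open iff for every $x\in U$ there is $n\in\mathbb N$ with $\bigcap_{k=1}^nV_k^x\subset U$; the triple $(X,d,\mathcal V)$, equipped with this topology, is called a weakly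 symmetric space. In a weakly symmetric space $(X,d,\mathcal V)$, a sequence $(x_n)_n$ is $\mathcal V$-converging to $x$, written $x_n\overset{\mathcal V}{\longrightarrow}x$, if for each $m\in\mathbb N$ the set $\{x_n\mid n\in\mathbb N\}\setminus\bigcap_{k=1}^mV_k^x$ is finite. A sequence is injective if its terms are pairwise distinct. For $A\subset X$, $C_{\mathcal V}(A)=A\cup\{x\in X\mid$ there is an injective sequence $(x_n)_n$ in $A$ with $x_n\overset{\mathcal V}{\longrightarrow}x\}$. A weakly symmetric space $(X,d,\mathcal V)$ is weakly semi-metric if $\overline A=C_{\mathcal V}(A)$ for every $A\subset X$ (closure in $\mathcal T_{d,\mathcal V}$) and the following holds: for every sequence $(x_n)_{n\in\mathbb N}$ in $X$ and every $x\in X$ with $x\in\bigcap_nV_n^{x_n}$, one has $\bigcap_nV_n^{x_n}=\{x\}$, and if moreover $x_n\in\bigcap_{k=1}^nV_k^{x_k}$ for every $n$, then $(x_n)_n$ converges to $x$. A topological space is weakly semi-metrizable if its topology equals $\mathcal T_{d,\mathcal V}$ for some weakly semi-metric space $(X,d,\mathcal V)$. *)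

(* Defs.v *)
From HB Require Import structures.
From mathcomp Require Import all_boot all_order all_algebra.
From mathcomp Require Import all_classical all_reals all_analysis.

Set Implicit Arguments.
Unset Strict Implicit.
Unset Printing Implicit Defensive.

Import Order.TTheory GRing.Theory Num.Theory.

Local Open Scope classical_set_scope.
Local Open Scope ring_scope.

(* Sequences indexed by {1, 2, 3, ...} are represented by functions on nat, the
   value at n being the term of index n + 1.  Accordingly, the intersection of
   the terms of indices 1, ..., n + 1 is [\bigcap_(k < n.+1) F k], and the
   radius attached to the index n + 1 is [2 ^- n.+1]. *)

Section weakly_developable.
Context {X : topologicalType}.

Definition open_covering (G : set_system X) : Prop :=
  G `<=` open /\ cover G id = setT.

Definition base_at (x : X) (B : set_system X) : Prop :=
  B `<=` open_nbhs x /\ filter_from B id --> x.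

Definition weak_development (G : nat -> set_system X) : Prop :=
  (forall n, open_covering (G n)) /\
  forall (x : X) (U : nat -> set X),
    (forall n, U n x /\ G n (U n)) ->
    base_at x (range (fun n => \bigcap_(k < n.+1) U k)).

End weakly_developable.

Definition weakly_developable (X : topologicalType) : Prop :=
  exists G : nat -> set_system X, weak_development G.

Section distance.
Context {R : realType} {X : Type}.
Implicit Types (d : X -> X -> R) (V : X -> nat -> set X).

Definition distance_function d : Prop :=
  [/\ forall x y, 0 <= d x y,
      forall x y, d x y = 0 <-> x = y
    & forall x y, d x y = d y x].

Definition dball d (x : X) (e : R) : set X := [set y | d x y < e].

Definition adapted d V : Prop :=
  forall x n, (\bigcap_(k < n.+1) V x k) x /\
              \bigcap_(k < n.+1) V x k `<=` dball d x (2 ^- n.+1).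

End distance.

Definition wsym_open {X : Type} (V : X -> nat -> set X) : set_system X :=
  [set U | forall x, U x -> exists n, \bigcap_(k < n.+1) V x k `<=` U].

(* The type X, endowed with the topology T_{d,V}.  This topology depends on V
   only, and is a topology for arbitrary V, adapted to d or not. *)
Definition wsymType {R : realType} {X : choiceType} (d : X -> X -> R)
  (V : X -> nat -> set X) : Type := X.

Section wsym_topology.
Context {R : realType} {X : choiceType}.
Variables (d : X -> X -> R) (V : X -> nat -> set X).

Let wsym_openT : wsym_open V setT.
Proof. by move=> x _; exists 0%N. Qed.

Let wsym_openI : setI_closed (wsym_open V).
Proof.
move=> A B oA oB x [Ax Bx].
have [m mA] := oA x Ax; have [n nB] := oB x Bx.
exists (maxn m n) => y Vy; split.
  by apply: mA => k /= km; apply: Vy; rewrite /= (leq_trans km)// ltnS leq_maxl.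
by apply: nB => k /= kn; apply: Vy; rewrite /= (leq_trans kn)// ltnS leq_maxr.
Qed.

Let wsym_open_bigU (I : Type) (f : I -> set X) :
  (forall i, wsym_open V (f i)) -> wsym_open V (\bigcup_i f i).
Proof.
move=> of_ x [i _ fix_]; have [n nf] := of_ i x fix_.
by exists n => y /nf fiy; exists i.
Qed.

HB.instance Definition _ := Choice.on (wsymType d V).
HB.instance Definition _ := isOpenTopological.Build (wsymType d V)
  wsym_openT wsym_openI wsym_open_bigU.

Lemma open_wsymE : @open (wsymType d V) = wsym_open V.
Proof. by []. Qed.

End wsym_topology.

Definition Vconverges {X : Type} (V : X -> nat -> set X) (u : nat -> X) (x : X)
    : Prop :=
  forall m, finite_set (range u `\` \bigcap_(k < m.+1) V x k).

Definition Cclosure {X : Type} (V : X -> nat -> set X) (A : set X) : set X :=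
  A `|` [set x | exists u : nat -> X,
    [/\ injective u, forall n, A (u n) & Vconverges V u x]].

Definition weakly_semi_metric {R : realType} {X : choiceType}
    (d : X -> X -> R) (V : X -> nat -> set X) : Prop :=
  [/\ distance_function d,
      adapted d V,
      forall A : set X, closure (A : set (wsymType d V)) = Cclosure V A
    & forall (u : nat -> X) (x : X), (\bigcap_n V (u n) n) x ->
        \bigcap_n V (u n) n = [set x] /\
        ((forall n, (\bigcap_(k < n.+1) V (u k) k) (u n)) ->
         (u : nat -> wsymType d V) @ \oo --> (x : wsymType d V))].

Definition weakly_semi_metrizable (R : realType) (X : topologicalType) : Prop :=
  exists (d : X -> X -> R) (V : X -> nat -> set X),
    weakly_semi_metric d V /\ @open X = @open (wsymType d V).

(* Main.v *)
(** Choose [g x n] in the [n]-th cover of a weak development with [x] in it, and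
    let [V x n] be the intersection of [g x 0, ..., g x n].  Since [V x] is
    decreasing, two points that share some [V z n] for infinitely many [n] share
    some [V z n] for every [n], hence a member of each cover, and so are equal;
    thus the infimum of [2 ^- n.+2] over all [n] such that the two points share
    some [V z n] is positive for distinct points, and it serves as [d].  For the
    last axiom of weakly semi-metric spaces, [x] in [V (u n) n] for all [n] makes
    [g (u n) n] a sequence to which the weak development applies at [x]. *)

Require Import Defs.
From mathcomp Require Import all_boot all_order all_algebra.
From mathcomp Require Import all_classical all_reals all_analysis.

Import Order.TTheory GRing.Theory Num.Theory.

Local Open Scope classical_set_scope.
Local Open Scope ring_scope.

Section weak_development.
Context {X : topologicalType} {G : nat -> set_system X}.
Hypothesis wdG : weak_development G.

Lemma weak_development_nbhs {x : X} {U : nat -> set X} {A : set X} :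
  (forall n, U n x /\ G n (U n)) -> nbhs x A ->
  exists n, \bigcap_(k < n.+1) U k `<=` A.
Proof.
move=> GU xA; have [_ /(_ _ xA)] := wdG.2 x U GU.
by case=> _ [n _ <-] UA; exists n.
Qed.

(** In a T1 space the complement of a point [y] other than [x] is a neighbourhood of [x], so some
    finite intersection misses [y]. *)
Lemma weak_development_bigcap {x : X} {U : nat -> set X} :
  accessible_space X ->
  (forall n, U n x /\ G n (U n)) -> \bigcap_n U n = [set x].
Proof.
move=> T1 GU; apply/seteqP; split=> [y Uy|_ -> n _]; last by case: (GU n).
apply: contrapT => /eqP yx.
have xA : nbhs x (~` [set y]).
  apply: open_nbhs_nbhs; split; last by move=> /= /esym/eqP; exact/negP.
  by rewrite openC; exact: accessible_closed_set1.
have [n UA] := weak_development_nbhs GU xA.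
by apply: (UA y) => // k _; exact: Uy.
Qed.

Lemma weak_development_choice :
  exists g : X -> nat -> set X, forall x n, g x n x /\ G n (g x n).
Proof.
have /choice[g gP] (p : X * nat) : exists U : set X, U p.1 /\ G p.2 U.
  have [_ cG] := wdG.1 p.2.
  have [U GU Up] : cover (G p.2) id p.1 by rewrite cG.
  by exists U.
by exists (fun x n => g (x, n)) => x n; exact: gP.
Qed.

End weak_development.

Definition meets {X : Type} (g : X -> nat -> set X) (x : X) (n : nat) : set X :=
  \bigcap_(k < n.+1) g x k.

Lemma meets_le {X : Type} (g : X -> nat -> set X) (x : X) (m n : nat) :
  (m <= n)%N -> meets g x n `<=` meets g x m.
Proof. by move=> mn y gy k /= km; apply: gy; rewrite /= (leq_trans km). Qed.

Lemma sub_meets {X : Type} (g : X -> nat -> set X) (x : X) (n : nat) :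
  meets g x n `<=` g x n.
Proof. by move=> y; apply => /=. Qed.

(** Reduces the finite intersections in [adapted], [wsym_open] and [Vconverges] to a single set. *)
Lemma bigcap_meets {X : Type} (g : X -> nat -> set X) (x : X) (n : nat) :
  \bigcap_(k < n.+1) meets g x k = meets g x n.
Proof.
apply/seteqP; split=> y gy; first by apply: gy => /=.
by move=> k /= kn; apply: meets_le gy.
Qed.

Section sharing_distance.
Context {R : realType} {X : Type}.
Variable V : X -> nat -> set X.
Implicit Types (x y z : X) (n m : nat).

Definition sharing y1 y2 : set nat := [set n | exists z, V z n y1 /\ V z n y2].

(* The element 1 keeps the infimum away from the junk value of [inf set0]. *)
Definition sharing_radii y1 y2 : set R :=
  1 |` [set 2 ^- n.+2 | n in sharing y1 y2].

Definition sharing_dist y1 y2 : R := inf (sharing_radii y1 y2).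

Lemma sharing_dist_ge y1 y2 e :
  e <= 1 -> (forall n, sharing y1 y2 n -> e <= 2 ^- n.+2) ->
  e <= sharing_dist y1 y2.
Proof.
move=> e1 en; apply: lb_le_inf; first by exists 1; left.
by move=> _ [->//|[n yn <-]]; exact: en.
Qed.

Lemma sharing_dist_ge0 y1 y2 : 0 <= sharing_dist y1 y2.
Proof. by apply: sharing_dist_ge => // n _; rewrite invr_ge0 exprn_ge0. Qed.

(** The infimum gives only a non-strict bound; using the radius [2 ^- n.+2], half of the target,
    makes it strict. *)
Lemma sharing_dist_lt y1 y2 n :
  sharing y1 y2 n -> sharing_dist y1 y2 < 2 ^- n.+1.
Proof.
move=> yn; apply: (@le_lt_trans _ _ (2 ^- n.+2)); last first.
  by rewrite ltf_pV2 ?posrE ?exprn_gt0// ltr_eXn2l// ltr1n.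
apply: ge_inf; last by right; exists n.
by exists 0 => _ [->//|[m _ <-]]; rewrite invr_ge0 exprn_ge0.
Qed.

Lemma sharing_distC y1 y2 : sharing_dist y1 y2 = sharing_dist y2 y1.
Proof.
suff yC : sharing y1 y2 = sharing y2 y1.
  by rewrite /sharing_dist /sharing_radii yC.
by apply/seteqP; split=> n [z [? ?]]; exists z.
Qed.

(** For decreasing [V], [sharing y1 y2] is closed downwards: if it misses [n], its elements are
    below [n] and the infimum is at least [2 ^- n.+2]. *)
Lemma sharing_dist_eq0 y1 y2 :
  (forall z m n, (m <= n)%N -> V z n `<=` V z m) ->
  sharing_dist y1 y2 = 0 <-> forall n, sharing y1 y2 n.
Proof.
move=> decV; split=> [d0 n|yn].
  apply: contrapT => yn.
  suff : 2 ^- n.+2 <= sharing_dist y1 y2 by rewrite d0 leNgt invr_gt0 exprn_gt0.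
  apply: sharing_dist_ge => [|m [z [y1m y2m]]].
    by rewrite invf_le1 ?exprn_gt0// exprn_ege1// ler1n.
  have mn : (m <= n)%N.
    rewrite leqNgt; apply/negP => /ltnW nm; apply: yn.
    by exists z; split; apply: decV nm _ _.
  by rewrite lef_pV2 ?posrE ?exprn_gt0// ler_eXn2l// ltr1n.
apply/eqP; rewrite eq_le sharing_dist_ge0 andbT.
apply/ler_addgt0Pr => e e0; rewrite add0r.
have [n ne] := ltr_add_invr e0.
rewrite add0r in ne; apply/ltW/(lt_trans (sharing_dist_lt _ _ _ (yn n))).
apply: le_lt_trans ne.
by rewrite lef_pV2 ?posrE ?exprn_gt0 ?ltr0n// -natrX ler_nat ltnW// ltn_expl.
Qed.

End sharing_distance.

Section semi_metric_of_weak_development.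
Context {R : realType} {X : topologicalType} {G : nat -> set_system X}.
Variable g : X -> nat -> set X.
Hypotheses (T1 : accessible_space X) (wdG : weak_development G).
Hypothesis gP : forall x n, g x n x /\ G n (g x n).

Let V : X -> nat -> set X := meets g.
Let d : X -> X -> R := sharing_dist V.

Let V_refl x n : V x n x.
Proof. by move=> k _; case: (gP x k). Qed.

(** The set belongs to the base at [x] obtained from [g x], and [base_at] includes openness. *)
Lemma open_meets x n : open (V x n).
Proof. by have [/(_ (V x n))[]] := wdG.2 x (g x) (gP x); first by exists n. Qed.

Let V_nbhs x n : nbhs x (V x n).
Proof. by apply: open_nbhs_nbhs; split=> //; exact: open_meets. Qed.

Let V_base x A : nbhs x A -> exists n, V x n `<=` A.
Proof. exact: (weak_development_nbhs wdG (gP x)). Qed.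

Lemma open_meets_wsym : @open X = @open (wsymType d V).
Proof.
rewrite open_wsymE; apply/seteqP; split=> U /=.
  move=> oU x Ux; have [n nU] := V_base _ _ (open_nbhs_nbhs (conj oU Ux)).
  by exists n; rewrite bigcap_meets.
move=> oU; rewrite openE => x /oU[n]; rewrite bigcap_meets => nU.
exact: filterS nU _.
Qed.

Let nbhs_wsym (x : X) : nbhs (x : wsymType d V) = nbhs x.
Proof.
by rewrite predeqE => A; rewrite !nbhsE /open_nbhs -open_meets_wsym.
Qed.

Lemma distance_sharing_meets : distance_function d.
Proof.
split; [exact: sharing_dist_ge0| |exact: sharing_distC] => x y.
rewrite sharing_dist_eq0; last by move=> *; exact: meets_le.
split=> [/choice[c cP]|<- n]; last by exists x.
(* The centres [c n] vary with [n], but the sets [g (c n) n] all contain [x], so the weak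
   development applies to them at [x]. *)
suff : (\bigcap_n g (c n) n) y.
  rewrite (@weak_development_bigcap _ _ wdG x)// => n.
  by split; [apply: sub_meets; case: (cP n)|case: (gP (c n) n)].
by move=> n _; apply: sub_meets; case: (cP n).
Qed.

Lemma closure_meets (A : set X) : closure A = Cclosure V A.
Proof.
apply/seteqP; split=> x; last first.
  case=> [/subset_closure//|[u [u_inj Au ux]]] B /V_base[m mB].
  (* If [A] missed [B], no [u n] would lie in [V x m], and the injective [u] would have finite
     range. *)
  apply: contrapT => AB0; apply: infinite_nat.
  suff -> : [set: nat] = u @^-1` (range u `\` \bigcap_(k < m.+1) V x k).
    by apply: finite_preimage (ux m) => ? ? _ _; exact: u_inj.
  apply/esym/seteqP; split=> // n _; split; first by exists n.
  by rewrite bigcap_meets => /mB Bu; apply: AB0; exists (u n).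
move=> clAx; have [Ax|nAx] := pselect (A x); [by left|right].
(* The list [p.1] holds the points to avoid. Finite sets are closed; [x] is removed from the list so
   that the complement is a neighbourhood of [x], and is avoided anyway since it is not in [A]. *)
have /choice[f fP] (p : seq X * nat) :
    exists y, [/\ A y, V x p.2 y & y \notin p.1].
  have finD : finite_set ([set` p.1] `\ x) by exact/finite_setD/finite_seq.
  have oD : open (~` ([set` p.1] `\ x)).
    by rewrite openC; exact: accessible_finite_set_closed.1.
  have [|y [Ay [Vy Dy]]] := clAx (V x p.2 `&` ~` ([set` p.1] `\ x)).
    apply: filterI => //; apply: open_nbhs_nbhs; split=> //.
    by move=> [_]; exact.
  exists y; split=> //; apply/negP => py; apply: Dy; split=> //= yx.
  by apply: nAx; rewrite -yx.
(* [s n] lists the first [n] terms of [u], which the next term must avoid. *)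
pose s := fix s n := if n is n'.+1 then f (s n', n') :: s n' else [::].
pose u n := f (s n, n).
have us m n : (m < n)%N -> u m \in s n.
  elim: n => // n IH; rewrite ltnS leq_eqVlt inE => /predU1P[->|/IH ->].
    by rewrite eqxx.
  by rewrite orbT.
exists u; split.
- have uP m n : (m < n)%N -> u m <> u n.
    by move=> /us + mn; rewrite mn; apply/negP; case: (fP (s n, n)).
  by move=> m n umn; case: (ltngtP m n) => // /uP; [|move/nesym].
- by move=> n; case: (fP (s n, n)).
(* From index [m] on, the terms lie in [V x m], so the exceptions are among the first [m] terms. *)
- move=> m; apply: (sub_finite_set _ (finite_seq (s m))).
  move=> _ [[n _ <-]]; rewrite bigcap_meets => nV.
  apply: us; rewrite ltnNge; apply/negP => mn; apply: nV.
  by apply: meets_le mn _ _; case: (fP (s n, n)).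
Qed.

Lemma weakly_semi_metric_meets : weakly_semi_metric d V.
Proof.
split; first exact: distance_sharing_meets.
- move=> x n; rewrite bigcap_meets; split=> [|y Vy]; first exact: V_refl.
  by rewrite /dball /=; apply: sharing_dist_lt; exists x.
- move=> A; rewrite -closure_meets; apply/seteqP.
  by split=> x clA B xB; apply: clA; [rewrite nbhs_wsym|rewrite -nbhs_wsym].
move=> u x ux.
have gu n : g (u n) n x /\ G n (g (u n) n).
  by split; [apply: sub_meets; exact: ux|case: (gP (u n) n)].
split.
  apply/seteqP; split=> [y Vy|_ ->//].
  rewrite -(weak_development_bigcap wdG T1 gu) => n _.
  by apply: sub_meets; exact: Vy.
move=> uV A; rewrite nbhs_wsym => /(weak_development_nbhs wdG gu)[n nA].
(* For [k <= n <= m], [uV] puts [u m] in [V (u k) k], hence in [g (u k) k]. *)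
exists n => // m /= nm; apply: nA => k /= kn.
by apply: sub_meets; apply: uV; rewrite /= (leq_trans kn).
Qed.

End semi_metric_of_weak_development.

Theorem theorem3p7 (R : realType) (X : topologicalType)
    (T1 : accessible_space X) (wd : weakly_developable X) :
  weakly_semi_metrizable R X /\
  exists (d : X -> X -> R) (V : X -> nat -> set X),
    [/\ weakly_semi_metric d V,
        @open X = @open (wsymType d V)
      & forall (x : X) (n : nat),
          open (V x n) /\
          forall y1 y2 : X, V x n y1 -> V x n y2 -> d y1 y2 < 2 ^- n.+1].
Proof.
have [G wdG] := wd; have [g gP] := weak_development_choice wdG.
have semi := weakly_semi_metric_meets (R := R) g T1 wdG gP.
have openE := open_meets_wsym (R := R) g wdG gP.
split; first by exists (sharing_dist (meets g)), (meets g).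
exists (sharing_dist (meets g)), (meets g); split=> // x n; split.
  exact: (open_meets g wdG gP).
by move=> y1 y2 y1n y2n; apply: sharing_dist_lt; exists x.
Qed.
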